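(* Let $k\ge 1$, let $n_1,n_1',n_1'',n_2,\dots,n_k$ be non-negative integers with $n_1=n_1'+n_1''+1$, and let $s,s',s''$, $a_1$, $a_j,a_j',a_j''$ ($2\le j\le k$) be non-negative integers with $s=s'+s''$ and $a_j=a_j'+a_j''$ for $j=2,\dots,k$. Suppose that (1) $T(n_1',n_2,\dots,n_k;\,s';\,a_1+s'',a_2',\dots,a_k')$ is true and superabundant, and (2) $T(n_1'',n_2,\dots,n_k;\,s'';\,a_1+s',a_2'',\dots,a_k'')$ is true and superabundant. Then $T(n_1,n_2,\dots,n_k;\,s;\,a_1,a_2,\dots,a_k)$ is true and superabundant.
   Context: Work over a field of characteristic zero (not necessarily algebraically closed). For non-negative integers $n_1,\dots,n_k$ let $V_i$ be a vector space of dimension $n_i+1$ and let $X=\mathbf{P}^{n_1}\times\cdots\times\mathbf{P}^{n_k}=\mathbf{P}(V_1)\times\cdots\times\mathbf{P}(V_k)$ be the Segre variety embedded in $\mathbf{P}(V_1\otimes\cdots\otimes V_k)$. For a point $p=v_1\otimes\cdots\otimes v_k$ of $X$ put $$G^i_pX=v_1\otimes\cdots\otimes v_{i-1}\otimes V_i\otimes v_{i+1}\otimes\cdots\otimes v_k,\qquad T_pX=\sum_{i=1}^k G^i_pX,$$ both linear subspaces of $V_1\otimes\cdots\otimes V_k$ ($T_pX$ is the affine tangent space). Given non-negative integers $s,a_1,\dots,a_k$, the statement $T(n_1,\dots,n_k;s;a_1,\dots,a_k)$ is said to be true if, for $s+a_1+\cdots+a_k$ generic points $p_1,\dots,p_s$,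 $q_{i,j}$ ($1\le i\le k$, $1\le j\le a_i$) of $X$, the subspace $\sum_{l=1}^sT_{p_l}X+\sum_{i=1}^k\sum_{j=1}^{a_i}G^i_{q_{i,j}}X$ of $V_1\otimes\cdots\otimes V_k$ has dimension $$\min\Big\{s\Big(1+\sum_{i=1}^kn_i\Big)+\sum_{i=1}^ka_i(n_i+1),\ \prod_{i=1}^k(n_i+1)\Big\}.$$ It is called superabundant if $s(1+\sum n_i)+\sum a_i(n_i+1)\ge\prod(n_i+1)$. *)

(* Defs.v *)
From HB Require Import structures.
From mathcomp Require Import all_boot all_order all_algebra.
From mathcomp Require Import mpoly.

Set Implicit Arguments.
Unset Strict Implicit.
Unset Printing Implicit Defensive.

Import GRing.Theory.
Local Open Scope ring_scope.

(* V_i is F^(n_i + 1); V_1 (x) ... (x) V_k is the space of k-dimensional arrays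
   of shape (n_1 + 1) x ... x (n_k + 1). *)
Notation multi_index n := {dffun forall i, 'I_(n i).+1}.

Notation tensor F n := {ffun multi_index n -> F^o}.

Notation vectors F n := (forall i, 'rV[F]_(n i).+1).

Definition pure_tensor (F : fieldType) (k : nat) (n : 'I_k -> nat)
    (v : vectors F n) : tensor F n :=
  [ffun c : multi_index n => \prod_(i < k) v i 0 (c i)].

(* w |-> v_1 (x) ... (x) v_(i-1) (x) w (x) v_(i+1) (x) ... (x) v_k *)
Definition slot (F : fieldType) (k : nat) (n : 'I_k -> nat)
    (v : vectors F n) (i : 'I_k) (w : 'rV[F]_(n i).+1) : tensor F n :=
  pure_tensor (dfwith v w).

Lemma slotE (F : fieldType) (k : nat) (n : 'I_k -> nat)
    (v : vectors F n) (i : 'I_k) (w : 'rV[F]_(n i).+1) (c : multi_index n) :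
  slot v w c = w 0 (c i) * \prod_(j < k | j != i) v j 0 (c j).
Proof.
rewrite ffunE (bigD1 i) //= dfwith_in; congr (_ * _).
by apply: eq_bigr => j ji; rewrite dfwith_out // eq_sym.
Qed.

Lemma slot_is_linear (F : fieldType) (k : nat) (n : 'I_k -> nat)
    (v : vectors F n) (i : 'I_k) : linear (@slot F k n v i).
Proof.
move=> a w1 w2; apply/ffunP => c.
by rewrite [RHS]ffunE [in RHS]ffunE !slotE !mxE mulrDl -mulrA.
Qed.

HB.instance Definition _ (F : fieldType) (k : nat) (n : 'I_k -> nat)
    (v : vectors F n) (i : 'I_k) :=
  GRing.isLinear.Build F 'rV[F]_(n i).+1 (tensor F n) _ (@slot F k n v i)
    (@slot_is_linear F k n v i).

Definition Gspace (F : fieldType) (k : nat) (n : 'I_k -> nat)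
    (v : vectors F n) (i : 'I_k) : {vspace tensor F n} :=
  limg (linfun (@slot F k n v i)).

Lemma GspaceP (F : fieldType) (k : nat) (n : 'I_k -> nat)
    (v : vectors F n) (i : 'I_k) (t : tensor F n) :
  reflect (exists w, t = slot v (i := i) w) (t \in Gspace v i).
Proof.
apply: (iffP memv_imgP) => [[w _ ->]|[w ->]]; exists w; rewrite ?lfunE //.
exact: memvf.
Qed.

Definition tangent_space (F : fieldType) (k : nat) (n : 'I_k -> nat)
    (v : vectors F n) : {vspace tensor F n} :=
  (\sum_(i < k) Gspace v i)%VS.

(* A point of X is given by a representative (v_1, ..., v_k) with all
   v_i nonzero; a family of points of X by a family of representatives. *)
Definition is_family (F : fieldType) (k : nat) (n : 'I_k -> nat) (J : finType)
    (x : J -> vectors F n) : Prop :=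
  forall j i, x j i != 0.

Definition coordinate (k : nat) (n : 'I_k -> nat) (J : finType) : finType :=
  (J * {i : 'I_k & 'I_(n i).+1})%type.

Definition multihomogeneous (F : fieldType) (k : nat) (n : 'I_k -> nat)
    (J : finType) (f : {mpoly F[#|coordinate n J|]}) : Prop :=
  exists d : J -> 'I_k -> nat, forall m, m \in msupp f -> forall j i,
    (\sum_(c < (n i).+1)
       m (enum_rank ((j, Tagged (fun i => 'I_(n i).+1) c) : coordinate n J)))%N
    = d j i.

Definition coordinates (F : fieldType) (k : nat) (n : 'I_k -> nat)
    (J : finType) (x : J -> vectors F n) : 'I_#|coordinate n J| -> F :=
  fun e => let: (j, c) := enum_val e in x j (tag c) 0 (tagged c).

(* Zariski-open subsets of X^J (a product of projective spaces): complements of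
   common zero loci of multihomogeneous polynomials in the coordinates. *)
Definition zariski_open (F : fieldType) (k : nat) (n : 'I_k -> nat)
    (J : finType) (U : (J -> vectors F n) -> Prop) : Prop :=
  exists2 S : {mpoly F[#|coordinate n J|]} -> Prop,
    forall f, S f -> multihomogeneous f &
    forall x, is_family x ->
      (U x <-> exists2 f, S f & f.@[coordinates x] != 0).

Definition for_generic_points (F : fieldType) (k : nat) (n : 'I_k -> nat)
    (J : finType) (P : (J -> vectors F n) -> Prop) : Prop :=
  exists U : (J -> vectors F n) -> Prop,
    [/\ zariski_open U,
        exists2 x, is_family x & U x &
        forall x, is_family x -> U x -> P x].

Definition point_index (k s : nat) (a : 'I_k -> nat) : finType :=
  ('I_s + {i : 'I_k & 'I_(a i)})%type.

Definition p_index (k s : nat) (a : 'I_k -> nat) (l : 'I_s) :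
  point_index s a := inl l.

Definition q_index (k s : nat) (a : 'I_k -> nat) (i : 'I_k) (j : 'I_(a i)) :
  point_index s a := inr (Tagged (fun i => 'I_(a i)) j).

Definition spanned_space (F : fieldType) (k : nat) (n : 'I_k -> nat)
    (s : nat) (a : 'I_k -> nat) (x : point_index s a -> vectors F n) :
    {vspace tensor F n} :=
  (\sum_(l < s) tangent_space (x (p_index a l)) +
   \sum_(i < k) \sum_(j < a i) Gspace (x (q_index s j)) i)%VS.

Definition expected_count (k : nat) (n : 'I_k -> nat) (s : nat)
    (a : 'I_k -> nat) : nat :=
  (s * (1 + \sum_(i < k) n i) + \sum_(i < k) a i * (n i).+1)%N.

Definition ambient_dim (k : nat) (n : 'I_k -> nat) : nat :=
  (\prod_(i < k) (n i).+1)%N.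

Lemma dim_tensor (F : fieldType) (k : nat) (n : 'I_k -> nat) :
  \dim {: tensor F n} = ambient_dim n.
Proof.
rewrite dimvf /dim /= muln1 card_dep_ffun foldrE big_map big_enum /=.
by apply: eq_bigr => i _; rewrite card_ord.
Qed.

Definition T_true (F : fieldType) (k : nat) (n : k.-tuple nat) (s : nat)
    (a : k.-tuple nat) : Prop :=
  for_generic_points
    (fun x : point_index s (tnth a) -> vectors F (tnth n) =>
       \dim (spanned_space x) =
       minn (expected_count (tnth n) s (tnth a)) (ambient_dim (tnth n))).

Definition T_superabundant (k : nat) (n : k.-tuple nat) (s : nat)
    (a : k.-tuple nat) : Prop :=
  (ambient_dim (tnth n) <= expected_count (tnth n) s (tnth a))%N.

(* Main.v *)
From HB Require Import structures.
Require Import Defs.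
From mathcomp Require Import all_boot all_order all_algebra.
From mathcomp Require Import perm mpoly zify.

(** Since all the statements involved are superabundant, each of them says that
    the span of general points is the whole space.  Spanning is the non-vanishing
    of some maximal minor of a matrix whose entries are monomials in the
    coordinates, and every such minor is multihomogeneous
    ([generic_full_of_spanning]); so a single spanning family is enough to obtain
    the conclusion, and that family may be chosen as special as one likes.

    Write V for the first factor V_1, split it as V' + V'', and let W be the
    tensor product of the other factors.  Put s' of the points p in P(V'), the
    other s'' in P(V''), and for i > 1 put a'_i of the points q_(i,j) in P(V') and
    a''_i in P(V'').  If p = v (x) w has v in V', then T_p X contains, besides the
    tangent space of the smaller Segre variety at p, the summand
    G^1_p X = (V' + V'') (x) w, whose part V'' (x) w is the space G^1 of the other
    variety at a point with the same component w.  Likewise for v in V'', while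
    each G^1 at a point q_(1,j) contributes to both sides.  Hence the span
    contains the spans of the two families occurring in the hypotheses, one
    filling V' (x) W and the other V'' (x) W ([tensor_map_sub_spanned],
    [tensor_map_split]).

    The two families are not independent: they share the components in W of all
    the points p and of the q_(1,j).  So one needs a choice of the shared data for
    which both are general.  Both are linear projections of one family x of points
    of X: the component in V of a point p of x is projected to V' for one family
    and to V'' for the other, and this provides as well the first component that
    the hypotheses attach to a point at which only G^1 counts.  Choose x_0
    projecting to a good family on the left and x_1 projecting to a good family
    on the right.  Along the line x_0 + t (x_1 - x_0) each side is good for all
    but finitely many t ([zariski_open_line]), so some t is good for both, the
    field being infinite.  Replacing the points of x by their components in V' or
    V'' gives the special family ([exists_spanning_family]).

    The numerical condition is additive: both the expected count and the dimension
    of the ambient space are the sums of those of the two hypotheses. *)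
Set Implicit Arguments.
Unset Strict Implicit.
Unset Printing Implicit Defensive.

Import GRing.Theory.
Local Open Scope ring_scope.

(** * Tensors under multilinear maps *)

Lemma prod_sum_dffun (R : comPzSemiRingType) (I : finType) (T : I -> finType)
    (P : forall i, T i -> R) :
  \prod_i \sum_(c : T i) P i c =
  \sum_(t : {dffun forall i, T i}) \prod_i P i (t i).
Proof.
pose Q i := [ffun c => P i c].
rewrite (reindex (@dffun_of_fprod _ T)); last exact/onW_bij/dffun_of_fprod_bij.
transitivity (\sum_(t : fprod T) \prod_(i in I) Q i (t i)); last first.
  by apply: eq_bigr => t _; apply: eq_bigr => i _; rewrite !ffunE.
rewrite big_fprod; pose G i (u : {i & T i}) := untag 0 (Q i) u.
rewrite -(bigA_distr_big_dep (fun i => tagged_with T i) G).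
apply: eq_bigr => i _.
by rewrite -(big_tag (fun i => Q i)); apply: eq_bigr => c _; rewrite ffunE.
Qed.

Lemma pure_tensor_eq (F : fieldType) (k : nat) (n : 'I_k -> nat)
    (v w : vectors F n) :
  (forall i, v i = w i) -> pure_tensor v = pure_tensor w.
Proof.
by move=> vw; apply/ffunP => c; rewrite !ffunE; apply: eq_bigr => i _; rewrite vw.
Qed.

Lemma tensor_sum_pure (F : fieldType) (k : nat) (n : 'I_k -> nat)
    (t : tensor F n) :
  t = \sum_(c : multi_index n) (t c : F) *: pure_tensor (fun i => delta_mx 0 (c i)).
Proof.
apply/ffunP => c; rewrite sum_ffunE (bigD1 c) //= big1 => [|b nbc]; last first.
  rewrite !ffunE; have [i nbci] : exists i, b i != c i.
    apply/existsP; apply: contraNT nbc; rewrite negb_exists => /forallP bc.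
    by apply/eqP/ffunP => i; apply/eqP; move: (bc i); rewrite negbK.
  by rewrite (bigD1 i) //= mxE eq_sym (negPf nbci) /= mul0r scaler0.
rewrite !ffunE big1 ?addr0 => [|i _]; last by rewrite mxE !eqxx.
by rewrite /GRing.scale /= mulr1.
Qed.

(** The embedding of V'_1 (x) ... (x) V'_k into V_1 (x) ... (x) V_k comes from
    linear maps V'_i -> V_i that are in general different on each factor; matrices
    act on row vectors from the right.  Allowing arbitrary linear maps on all
    factors spares any transport between spaces of equal dimension. *)
Section TensorMap.
Variables (F : fieldType) (k : nat) (n' n : 'I_k -> nat).
Variable phi : forall i, 'M[F]_((n' i).+1, (n i).+1).

Definition tensor_map (t : tensor F n') : tensor F n :=
  [ffun c : multi_index n =>
     \sum_(b : multi_index n') (t b : F) * \prod_i phi i (b i) (c i)].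

Lemma tensor_map_is_linear : linear tensor_map.
Proof.
move=> a t u; apply/ffunP => c; rewrite !ffunE /GRing.scale /= mulr_sumr.
rewrite -big_split /=; apply: eq_bigr => b _.
by rewrite !ffunE mulrDl mulrA.
Qed.

HB.instance Definition _ := GRing.isLinear.Build F (tensor F n') (tensor F n)
  *:%R tensor_map tensor_map_is_linear.

Lemma tensor_map_pure (v : vectors F n') :
  tensor_map (pure_tensor v) = pure_tensor (fun i => v i *m phi i).
Proof.
apply/ffunP => c; rewrite !ffunE.
under [RHS]eq_bigr do rewrite mxE.
rewrite prod_sum_dffun; apply: eq_bigr => b _.
by rewrite ffunE big_split.
Qed.

Lemma tensor_map_Gspace (v : vectors F n') i t :
  t \in Gspace v i -> tensor_map t \in Gspace (fun j => v j *m phi j) i.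
Proof.
case/GspaceP=> w ->; apply/GspaceP; exists (w *m phi i).
rewrite /slot tensor_map_pure; apply: pure_tensor_eq => j.
by case: dfwithP => [|j' ij]; rewrite ?dfwith_in ?dfwith_out.
Qed.

End TensorMap.

Lemma slot_eq (F : fieldType) (k : nat) (n : 'I_k -> nat) (v w : vectors F n) i :
  (forall j, j != i -> v j = w j) -> slot v (i := i) =1 slot w (i := i).
Proof.
move=> vw u; apply: pure_tensor_eq => j.
case: dfwithP => [|j' ij]; first by rewrite dfwith_in.
by rewrite dfwith_out // vw // eq_sym.
Qed.

(** The i-th component of a point is irrelevant to its G^i; this is what makes
    points of different varieties interchangeable there. *)
Lemma Gspace_eq (F : fieldType) (k : nat) (n : 'I_k -> nat) (v w : vectors F n) i :
  (forall j, j != i -> v j = w j) -> Gspace v i = Gspace w i.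
Proof.
move=> vw; apply/vspaceP => t.
by apply/GspaceP/GspaceP=> -[u ->]; exists u; rewrite (slot_eq vw).
Qed.

(** The contribution of a marked point to the span: [None] marks the points p,
    [Some i] the points q_(i,j). *)
Definition span_at (F : fieldType) (k : nat) (n : 'I_k -> nat) (o : option 'I_k)
    (v : vectors F n) : {vspace tensor F n} :=
  if o is Some i then Gspace v i else tangent_space v.

Lemma span_at_eq (F : fieldType) (k : nat) (n : 'I_k -> nat) o (v w : vectors F n) :
  (forall i, v i = w i) -> span_at o v = span_at o w.
Proof.
move=> vw; have Gvw i : Gspace v i = Gspace w i by apply: Gspace_eq => j _.
by case: o => [i|] /=; [exact: Gvw | apply: eq_bigr].
Qed.

(** Whether G^i is part of the contribution marked by [o]. *)
Definition slot_allowed (k : nat) (o : option 'I_k) (i : 'I_k) : bool :=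
  if o is Some i' then i' == i else true.

Lemma Gspace_sub_span_at (F : fieldType) (k : nat) (n : 'I_k -> nat) o i
    (v : vectors F n) : slot_allowed o i -> (Gspace v i <= span_at o v)%VS.
Proof.
by case: o => [j /eqP<- //|_]; apply: sumv_sup.
Qed.

Lemma tensor_map_span_at (F : fieldType) (k : nat) (n' n : 'I_k -> nat)
    (phi : forall i, 'M[F]_((n' i).+1, (n i).+1)) o (v : vectors F n') t :
  t \in span_at o v -> tensor_map phi t \in span_at o (fun j => v j *m phi j).
Proof.
case: o => [i|] /=; first exact: tensor_map_Gspace.
case/memv_sumP=> ts tsP ->; rewrite linear_sum; apply: memv_sumr => i _.
exact/tensor_map_Gspace/tsP.
Qed.

(** * Genericity along a line *)

(** Cofiniteness, with the exceptional values confined to the roots of a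
    polynomial: in this form finite conjunctions are products of polynomials. *)
Definition almost_all (F : fieldType) (P : F -> Prop) : Prop :=
  exists2 g : {poly F}, g != 0 & forall t, g.[t] != 0 -> P t.

Lemma almost_all_and (F : fieldType) (P Q : F -> Prop) :
  almost_all P -> almost_all Q -> almost_all (fun t => P t /\ Q t).
Proof.
move=> [g g0 gP] [h h0 hQ]; exists (g * h); first by rewrite mulf_neq0.
by move=> t; rewrite hornerM mulf_eq0 negb_or => /andP[/gP ? /hQ].
Qed.

Lemma almost_all_forall (F : fieldType) (I : finType) (P : I -> F -> Prop) :
  (forall i, almost_all (P i)) -> almost_all (fun t => forall i, P i t).
Proof.
case/fin_all_exists2=> g g0 gP; exists (\prod_i g i).
  by apply/prodf_neq0 => i _.
move=> t; rewrite horner_prod => /prodf_neq0 gt i; exact/gP/gt.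
Qed.

(** The naturals below [size g] are that many distinct elements in characteristic
    zero, one more than [g] has room for among its roots. *)
Lemma almost_all_exists (F : fieldType) (P : F -> Prop) :
  [pchar F] =i pred0 -> almost_all P -> exists t, P t.
Proof.
move=> /pcharf0P charF0 [g g0 gP].
pose rs : seq F := [seq i%:R | i <- iota 0 (size g)].
have urs : uniq rs.
  rewrite map_inj_uniq ?iota_uniq // => i j.
  wlog ij : i j / (i <= j)%N => [hw eq_ij|/eqP].
    by case/orP: (leq_total i j) => /hw -> //.
  rewrite eq_sym -subr_eq0 -natrB // charF0 subn_eq0 => ji.
  by apply/eqP; rewrite eqn_leq ij.
have /allPn[t _ gt] : ~~ all (root g) rs.
  by apply/negP => /(max_poly_roots g0)/(_ urs); rewrite size_map size_iota ltnn.
by exists t; apply: gP.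
Qed.

Lemma almost_all_horner (F : fieldType) (g : {poly F}) t0 :
  g.[t0] != 0 -> almost_all (fun t => g.[t] != 0).
Proof. by move=> gt0; exists g => //; apply: contraNneq gt0 => ->; rewrite horner0. Qed.

Lemma meval_lineE (F : fieldType) N (f : {mpoly F[N]}) (u w : 'I_N -> F) t :
  (mmap polyC (fun e => (u e)%:P + 'X * (w e)%:P) f).[t] =
  f.@[fun e => u e + t * w e].
Proof.
rewrite /mmap mevalE horner_sum; apply: eq_bigr => m _.
rewrite hornerM hornerC; congr (_ * _); rewrite /mmap1 horner_prod.
by apply: eq_bigr => i _; rewrite horner_exp !hornerE.
Qed.

(** Restricted to a line, a polynomial in the coordinates becomes a polynomial in
    the parameter, and it is not the zero one when it does not vanish at
    [t0]. *)
Lemma zariski_open_line (F : fieldType) (k : nat) (n : 'I_k -> nat) (J : finType)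
    (U : (J -> vectors F n) -> Prop) (x0 u w : J -> vectors F n) t0 :
  zariski_open U -> is_family x0 -> U x0 ->
  (forall j i, x0 j i = u j i + t0 *: w j i) ->
  almost_all (fun t => let x j i := u j i + t *: w j i in is_family x /\ U x).
Proof.
move=> [S _ US] fam0 U0 x0E.
pose x t j i := u j i + t *: w j i.
have coordE t e :
    coordinates (x t) e = coordinates u e + t * coordinates w e.
  by rewrite /coordinates; case: (enum_val e) => j c; rewrite !mxE.
have famx : almost_all (fun t => is_family (x t)).
  apply: almost_all_forall => j; apply: almost_all_forall => i.
  (* a nonzero coordinate at t0 is a polynomial in t that is not zero *)
  have [c x0c] : exists c, x0 j i 0 c != 0.
    apply/existsP; apply: contraNT (fam0 j i) => /existsPn x00.
    by apply/eqP/rowP => c; rewrite mxE; apply/eqP; move: (x00 c); rewrite negbK.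
  have [] := @almost_all_horner F ((u j i 0 c)%:P + 'X * (w j i 0 c)%:P) t0.
    by rewrite !hornerE; move: x0c; rewrite x0E !mxE.
  move=> g g0 gP; exists g => // t /gP; rewrite !hornerE; apply: contraNneq.
  by move=> /rowP/(_ c); rewrite !mxE => ->.
have [f Sf f0] : exists2 f, S f & f.@[coordinates x0] != 0 by apply/US.
have Ux : almost_all (fun t => f.@[coordinates (x t)] != 0).
  have [] := @almost_all_horner F
    (mmap polyC (fun e => (coordinates u e)%:P + 'X * (coordinates w e)%:P) f) t0.
    rewrite meval_lineE; apply: contra_neq f0 => <-; apply: meval_eq => e.
    rewrite -coordE /coordinates; case: (enum_val e) => j c.
    by rewrite x0E.
  move=> g g0 gP; exists g => // t /gP; rewrite meval_lineE.
  by rewrite (meval_eq (v2 := coordinates (x t))).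
have [g g0 gP] := almost_all_and famx Ux; exists g => // t /gP[fx fU].
by split=> //; apply/US => //; exists f.
Qed.

(** * The spanning condition is open *)

Definition degree_at (k : nat) (n : 'I_k -> nat) (J : finType)
    (m : 'X_{1..#|coordinate n J|}) (j : J) (i : 'I_k) : nat :=
  (\sum_(c < (n i).+1)
     m (enum_rank ((j, Tagged (fun i => 'I_(n i).+1) c) : coordinate n J)))%N.

Definition has_multidegree (F : fieldType) (k : nat) (n : 'I_k -> nat)
    (J : finType) (d : J -> 'I_k -> nat) (f : {mpoly F[#|coordinate n J|]}) :=
  forall m, m \in msupp f -> forall j i, degree_at m j i = d j i.

Section Multidegree.
Variables (F : fieldType) (k : nat) (n : 'I_k -> nat) (J : finType).
Implicit Types (d : J -> 'I_k -> nat) (f g : {mpoly F[#|coordinate n J|]}).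

Lemma multidegree0 d : has_multidegree d (0 : {mpoly F[#|coordinate n J|]}).
Proof. by move=> m; rewrite msupp0. Qed.

Lemma multidegreeN d f : has_multidegree d f -> has_multidegree d (- f).
Proof. by move=> df m; rewrite (perm_mem (msuppN f)); apply: df. Qed.

Lemma multidegree_sum d (I : finType) (f : I -> {mpoly F[#|coordinate n J|]}) :
  (forall i, has_multidegree d (f i)) -> has_multidegree d (\sum_i f i).
Proof.
move=> df; elim/big_ind: _ => //; first exact: multidegree0.
by move=> p q dp dq m /msuppD_le; rewrite mem_cat => /orP[/dp|/dq].
Qed.

Lemma multidegreeM d1 d2 f g : has_multidegree d1 f -> has_multidegree d2 g ->
  has_multidegree (fun j i => d1 j i + d2 j i)%N (f * g).
Proof.
move=> df dg m /msuppM_le /allpairsP[[m1 m2] /= [/df d1E /dg d2E ->]] j i.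
rewrite -d1E -d2E /degree_at -big_split.
by apply: eq_bigr => c _; rewrite mnmDE.
Qed.

Lemma multidegree_prod (I : Type) (r : seq I) (P : pred I) (d : I -> J -> 'I_k -> nat)
    (f : I -> {mpoly F[#|coordinate n J|]}) :
  (forall i, has_multidegree (d i) (f i)) ->
  has_multidegree (fun j i => \sum_(l <- r | P l) d l j i)%N (\prod_(l <- r | P l) f l).
Proof.
move=> df; elim: r => [|l r IHr].
  move=> m; rewrite big_nil msupp1 inE => /eqP-> j i; rewrite big_nil /degree_at big1 //.
  by move=> c _; rewrite mnm0E.
rewrite big_cons; have [Pl|nPl] := ifP.
  move=> m mf j i; rewrite big_cons Pl.
  exact: (multidegreeM (df l) IHr mf).
by move=> m mf j i; rewrite big_cons nPl; apply: (IHr m mf).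
Qed.

(** Every term of the Leibniz expansion takes one entry from each row, so it is
    enough that the multidegree of an entry depends on its row alone. *)
Lemma multidegree_det (N : nat) (d : 'I_N -> J -> 'I_k -> nat)
    (M : 'M[{mpoly F[#|coordinate n J|]}]_N) :
  (forall b c, has_multidegree (d b) (M b c)) ->
  has_multidegree (fun j i => \sum_b d b j i)%N (\det M).
Proof.
move=> dM; apply: multidegree_sum => s; rewrite mulr_sign.
have dMs : has_multidegree (fun j i => \sum_b d b j i)%N (\prod_b M b (s b)).
  by apply: multidegree_prod => b; apply: dM.
by case: (s : bool) => //; apply: multidegreeN.
Qed.

Lemma multidegreeX (j0 : J) (i0 : 'I_k) (c0 : 'I_(n i0).+1) :
  has_multidegree (fun j i => (j0 == j) && (i0 == i) : nat)
    ('X_(enum_rank ((j0, Tagged (fun i => 'I_(n i).+1) c0) : coordinate n J)) :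
       {mpoly F[#|coordinate n J|]}).
Proof.
move=> m; rewrite msuppX inE => /eqP-> j i; rewrite /degree_at.
under eq_bigr do rewrite mnmE (inj_eq enum_rank_inj) xpair_eqE.
have [_|_] := eqVneq j0 j; last by rewrite big1.
have [<-{i}|ni] := eqVneq i0 i.
  rewrite (bigD1 c0) //= eqxx big1 // => c ncc0.
  by rewrite eq_Tagged /= eq_sym (negPf ncc0).
by rewrite big1 // => c _; rewrite -tag_eqE /tag_eq /= (negPf ni).
Qed.

End Multidegree.

Section Generators.
Variables (F : fieldType) (k : nat) (n : 'I_k -> nat) (J : finType).
Variable (o : J -> option 'I_k).

(** A family of vectors spanning the contribution of [x j].  It is indexed by all
    the coordinates of the points, and padded with zeros where G^i does not
    contribute, so that the index type does not depend on the marks. *)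
Definition generator (x : J -> vectors F n) (e : coordinate n J) : tensor F n :=
  if slot_allowed (o e.1) (tag e.2) then slot (x e.1) (delta_mx 0 (tagged e.2))
  else 0.

Lemma Gspace_basis (v : vectors F n) i :
  Gspace v i = (\sum_c <[slot v (delta_mx 0%R c : 'rV_(n i).+1)]>)%VS.
Proof.
apply/eqP; rewrite eqEsubv; apply/andP; split.
  apply/subvP => t /GspaceP[w ->]; rewrite (row_sum_delta w) linear_sum.
  by apply: memv_sumr => c _; rewrite linearZ; apply/memvZ/memv_line.
by apply/subv_sumP => c _; rewrite -memvE; apply/GspaceP; exists (delta_mx 0 c).
Qed.

Lemma span_generators (x : J -> vectors F n) :
  (\sum_j span_at (o j) (x j) = \sum_e <[generator x e]>)%VS.
Proof.
rewrite -(pair_bigA _ (fun j p => <[generator x (j, p)]>%VS)) /=.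
apply: eq_bigr => j _.
pose G i (c : 'I_(n i).+1) := <[generator x (j, Tagged (fun i => 'I_(n i).+1) c)]>%VS.
transitivity (\sum_i \sum_(c : 'I_(n i).+1) G i c)%VS; last first.
  by rewrite sig_big_dep; apply: eq_bigr => -[].
rewrite /G /generator /=; case: (o j) => [i|] /=; last first.
  by apply: eq_bigr => i _; rewrite Gspace_basis.
rewrite (bigD1 i) //= eqxx -Gspace_basis big1 ?addv0 // => i' nii'.
by rewrite eq_sym (negPf nii') big1.
Qed.

Definition generator_poly (e : coordinate n J) (b : multi_index n) :
    {mpoly F[#|coordinate n J|]} :=
  if slot_allowed (o e.1) (tag e.2) && (b (tag e.2) == tagged e.2) then
    \prod_(i | i != tag e.2)
      'X_(enum_rank ((e.1, Tagged (fun i => 'I_(n i).+1) (b i)) : coordinate n J))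
  else 0.

Lemma generator_polyE x e b :
  (generator_poly e b).@[coordinates x] = generator x e b.
Proof.
rewrite /generator_poly /generator; case: ifP => /= [/andP[-> be]|].
  rewrite slotE mxE be mul1r rmorph_prod; apply: eq_bigr => i _.
  by rewrite /= mevalXU /coordinates enum_rankK.
rewrite meval0; case: ifP => /= _; last by rewrite ffunE.
by rewrite slotE mxE => ->; rewrite mul0r.
Qed.

(** The slot variable has been specialised to a basis vector, so an entry is a
    product of one coordinate from each other component, or zero; its degrees
    therefore depend on the row [e] only. *)
Lemma generator_poly_multidegree e b :
  has_multidegree
    (fun j i => \sum_(i0 | i0 != tag e.2) ((e.1 == j) && (i0 == i)))%N
    (generator_poly e b).
Proof.
rewrite /generator_poly; case: ifP => _; last exact: multidegree0.
by apply: multidegree_prod => i; apply: multidegreeX.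
Qed.

Definition generator_mx (x : J -> vectors F n) :
    'M[F]_(#|coordinate n J|, #|{: multi_index n}|) :=
  \matrix_(e, b) generator x (enum_val e) (enum_val b).

(** The rows of the matrix are the coordinates of the generators: a left inverse
    amounts to writing each tensor of the standard basis as a combination of
    them. *)
Lemma row_full_generator_mx x :
  row_full (generator_mx x) = (\sum_j span_at (o j) (x j) == fullv)%VS.
Proof.
rewrite span_generators; apply/row_fullP/eqP => [[B BA]|full].
  apply/eqP; rewrite eqEsubv subvf /=; apply/subvP => t _.
  pose u e := \sum_b (t (enum_val b) : F) * B b (enum_rank e).
  have -> : t = \sum_e u e *: generator x e.
    apply/ffunP => b0; rewrite sum_ffunE.
    have := congr1 (fun A : 'M_#|{: multi_index n}| =>
      ((\row_b (t (enum_val b) : F)) *m A) 0 (enum_rank b0)) BA.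
    rewrite mulmxA mulmx1 mxE [LHS](reindex enum_rank) /=; last first.
      exact/onW_bij/enum_rank_bij.
    rewrite !mxE enum_rankK => <-.
    apply: eq_bigr => e _; rewrite !mxE !ffunE !enum_rankK; congr (_ * _).
    by apply: eq_bigr => b _; rewrite mxE.
  by apply: memv_sumr => e _; apply/memvZ/memv_line.
have /fin_all_exists[u uE] : forall b : multi_index n, exists u : coordinate n J -> F,
    [ffun c => (c == b)%:R] = \sum_e u e *: generator x e.
  move=> b; have := memvf ([ffun c => (c == b)%:R] : tensor F n).
  rewrite -full => /memv_sumP[ts tsP ->].
  have /fin_all_exists[u uE] e : exists a, ts e = a *: generator x e.
    exact/vlineP/tsP.
  by exists u; apply: eq_bigr => e _; rewrite uE.
exists (\matrix_(b, e) u (enum_val b) (enum_val e)).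
apply/matrixP => b c; rewrite !mxE.
have /ffunP/(_ (enum_val c)) := uE (enum_val b); rewrite ffunE.
rewrite (inj_eq enum_val_inj) eq_sym => ->; rewrite sum_ffunE.
rewrite (reindex (fun e : 'I_#|coordinate n J| => enum_val e)) /=; last first.
  exact/onW_bij/enum_val_bij.
by apply: eq_bigr => e _; rewrite !mxE ffunE.
Qed.

(** One maximal minor that is nonzero at [x0] cuts out a nonempty open set, and
    on this set the generators still span. *)
Lemma generic_full_of_spanning (x0 : J -> vectors F n) :
  is_family x0 -> (\sum_j span_at (o j) (x0 j) = fullv)%VS ->
  for_generic_points
    (fun x : J -> vectors F n => \sum_j span_at (o j) (x j) = fullv)%VS.
Proof.
move=> fam0 /eqP; rewrite -row_full_generator_mx => full0.
pose r := fullrankfun full0.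
pose M : 'M_#|{: multi_index n}| :=
  \matrix_(b, c) generator_poly (enum_val (r b)) (enum_val c).
have detE x : (\det M).@[coordinates x] = \det (rowsub r (generator_mx x)).
  rewrite -det_map_mx; congr (\det _); apply/matrixP => b c.
  by rewrite !mxE -generator_polyE.
have homM : multihomogeneous (\det M).
  eexists; apply: multidegree_det => b c; rewrite mxE.
  exact: generator_poly_multidegree.
exists (fun x => (\det M).@[coordinates x] != 0); split.
- exists (fun f => f = \det M) => [f ->//|x _].
  by split=> [?|[f ->]] //; exists (\det M).
- exists x0 => //; rewrite detE -unitfE -[_ \is a _]/(_ \in unitmx) -row_full_unit.
  exact: fullrowsub_full.
move=> x _; rewrite detE -unitfE -[_ \is a _]/(_ \in unitmx) -row_full_unit.
move=> /row_fullP[B BA]; apply/eqP; rewrite -row_full_generator_mx.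
apply/row_fullP; exists (B *m rowsub r 1%:M).
by rewrite -mulmxA mul_rowsub_mx mul1mx.
Qed.

End Generators.

(** * Codes of the marked points *)

(** Type and rank of a marked point.  The types [point_index s a] for different
    numbers of points are unrelated; their codes all live in the same type, where
    comparing them is arithmetic on natural numbers. *)
Definition code (k s : nat) (a : 'I_k -> nat) (j : point_index s a) :
    option 'I_k * nat :=
  match j with
  | inl l => (None, val l)
  | inr q => (Some (tag q), val (tagged q))
  end.

Lemma code_inj (k s : nat) (a : 'I_k -> nat) : injective (@code k s a).
Proof.
move=> [l|[i u]] [l'|[i' u']] //= []; first by move/val_inj->.
by move=> ii'; move: u'; rewrite -ii' => u' /val_inj->.
Qed.

Lemma spanned_spaceE (F : fieldType) (k : nat) (n : 'I_k -> nat) (s : nat)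
    (a : 'I_k -> nat) (x : point_index s a -> vectors F n) :
  spanned_space x = (\sum_j span_at (code j).1 (x j))%VS.
Proof.
rewrite big_sumType /= /spanned_space; congr (_ + _)%VS.
by rewrite sig_big_dep /=; apply: eq_bigr => -[i j].
Qed.

Definition valid_code (k s : nat) (a : 'I_k -> nat) (c : option 'I_k * nat) : bool :=
  (c.2 < if c.1 is Some i then a i else s)%N.

Lemma code_valid (k s : nat) (a : 'I_k -> nat) (p : point_index s a) :
  valid_code s a (code p).
Proof. by case: p => [l|[i j]] /=; apply: ltn_ord. Qed.

Lemma code_surj (k s : nat) (a : 'I_k -> nat) c :
  valid_code s a c -> exists p : point_index s a, code p = c.
Proof.
case: c => [[i|] j] ja; last by exists (inl (Ordinal ja)).
by exists (inr (Tagged (fun i => 'I_(a i)) (Ordinal (ja : j < a i)%N))).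
Qed.

(** The points of the left problem ([s'], [a']) and of the right problem ([s''],
    [a'']) as points of the total problem ([s' + s''], [a]), [i0] being the factor
    that is split.  The first s' points p belong to the left and the other s'' to
    the right; so do, for i other than i0, the first a'_i of the points q_(i,j)
    and the remaining ones.  The points q_(i0,j) with j < a_i0 belong to both,
    and on each side the further ones account for the points p of the other
    side. *)
Section PointCodes.
Variables (k : nat) (i0 : 'I_k).
Variables (s' s'' : nat) (a a' a'' : 'I_k -> nat).

Definition code_left (c : option 'I_k * nat) : option 'I_k * nat :=
  if (c.1 == Some i0) && (a i0 <= c.2)%N then (None, s' + (c.2 - a i0))%N else c.

Definition code_right (c : option 'I_k * nat) : option 'I_k * nat :=
  match c.1 with
  | None => (None, s' + c.2)%N
  | Some i => if i != i0 then (Some i, a' i + c.2)%N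
              else if (c.2 < a i0)%N then c else (None, c.2 - a i0)%N
  end.

(** Where the point is to be specialised.  The points of type [i0] lie on both
    sides, and putting them on the left is an arbitrary choice. *)
Definition on_left (c : option 'I_k * nat) : bool :=
  if c.1 is Some i then (i == i0) || (c.2 < a' i)%N else (c.2 < s')%N.

Lemma code_left_inj :
  a' i0 = (a i0 + s'')%N ->
  injective (fun p : point_index s' a' => code_left (code p)).
Proof.
move=> a'0 p q eq_pq; apply: code_inj; move: eq_pq.
have := code_valid p; have := code_valid q; rewrite /valid_code /code_left.
case: (code p) (code q) => [[i|] j] [[i'|] j'] /=; rewrite ?(inj_eq Some_inj).
all: repeat case: eqVneq => [->|?] /=; rewrite ?a'0.
all: by repeat case: leqP => ? //=; move=> h1 h2 []; intros; subst; congr (_, _); lia.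
Qed.

Lemma code_right_inj :
  a'' i0 = (a i0 + s')%N ->
  injective (fun p : point_index s'' a'' => code_right (code p)).
Proof.
move=> a''0 p q eq_pq; apply: code_inj; move: eq_pq.
have := code_valid p; have := code_valid q; rewrite /valid_code /code_right.
case: (code p) (code q) => [[i|] j] [[i'|] j'] /=.
all: repeat case: eqP => [->|?] /=; rewrite ?a''0.
all: repeat case: ltnP => ? //=; move=> h1 h2 []; intros; subst.
all: by first [contradiction | congr (_, _); lia].
Qed.

(** Either the point keeps its type and is specialised to this side, or its G^i0
    is all that the problem uses, and the point of the total problem provides
    that space, by itself or as part of its tangent space. *)
Lemma code_leftP (p : point_index s' a') :
  a' i0 = (a i0 + s'')%N -> (forall i, i != i0 -> a i = (a' i + a'' i)%N) ->
  valid_code (s' + s'') a (code_left (code p)) /\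
  (on_left (code_left (code p)) /\ (code_left (code p)).1 = (code p).1 \/
   (code p).1 = Some i0 /\ slot_allowed (code_left (code p)).1 i0).
Proof.
move=> a'0 aE.
have := code_valid p; rewrite /valid_code /code_left /on_left.
case: (code p) => [[i|] j] /=; last by split; [lia | left].
rewrite (inj_eq Some_inj); case: eqVneq => [->|ni] /= ja; last first.
  by split; [rewrite aE //; lia | left; rewrite ja orbT].
rewrite a'0 in ja; case: ifPn => aj /=; first by split; [lia | right].
by split; [lia | left; rewrite eqxx].
Qed.

Lemma code_rightP (p : point_index s'' a'') :
  a'' i0 = (a i0 + s')%N -> (forall i, i != i0 -> a i = (a' i + a'' i)%N) ->
  valid_code (s' + s'') a (code_right (code p)) /\
  (~~ on_left (code_right (code p)) /\ (code_right (code p)).1 = (code p).1 \/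
   (code p).1 = Some i0 /\ slot_allowed (code_right (code p)).1 i0).
Proof.
move=> a''0 aE.
have := code_valid p; rewrite /valid_code /code_right /on_left.
case: (code p) => [[i|] j] /=; last by split; [lia | left; split => //; lia].
case: eqVneq => [->|ni] /= ja; last first.
  by split; [rewrite aE //; lia | left; rewrite negb_or ni; split => //; lia].
rewrite a''0 in ja; case: ifPn => aj /=; first by split; [lia | right].
by split; [lia | right].
Qed.

Lemma code_left_onto c :
  a' i0 = (a i0 + s'')%N ->
  valid_code (s' + s'') a c -> on_left c ->
  exists p : point_index s' a', code_left (code p) = c.
Proof.
move=> a'0.
rewrite /valid_code /on_left => cv cl.
have /code_surj[p pc] : valid_code s' a' c.
  move: cv cl; rewrite /valid_code; case: c => [[i|] j] //=.
  by case: eqVneq => [->|] //=; rewrite a'0; lia.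
exists p; rewrite /code_left pc; case: c cv {cl pc} => [[i|] j] //=.
by rewrite (inj_eq Some_inj); case: eqVneq => [->|] //=; case: leqP.
Qed.

Lemma code_right_onto c :
  (forall i, i != i0 -> a i = (a' i + a'' i)%N) ->
  valid_code (s' + s'') a c -> ~~ on_left c ->
  exists p : point_index s'' a'', code_right (code p) = c.
Proof.
move=> aE.
rewrite /valid_code /on_left; case: c => [[i|] j] /=.
  rewrite negb_or => ja /andP[ni a'j]; rewrite aE // in ja.
  have /code_surj[p pc] : valid_code s'' a'' (Some i, j - a' i)%N.
    by rewrite /valid_code /=; lia.
  by exists p; rewrite pc /code_right /= ni; congr (_, _); lia.
move=> js s'j.
have /code_surj[p pc] : valid_code s'' a'' (None, j - s')%N.
  by rewrite /valid_code /=; lia.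
by exists p; rewrite pc /code_right /=; congr (_, _); lia.
Qed.

End PointCodes.

(** * Specialising points into two complementary subspaces *)

(** The image of a filled space is in the span of a family [z] as soon as each
    point of [x] has a counterpart in [z] with at least its contribution: the
    image of the same point with the same type, or, for G^i, a point that agrees
    with the image outside the factor i and has G^i in its contribution. *)
Lemma tensor_map_sub_spanned (F : fieldType) (k : nat) (n' n : 'I_k -> nat)
    (phi : forall i, 'M[F]_((n' i).+1, (n i).+1))
    (s' s : nat) (a' a : 'I_k -> nat)
    (x : point_index s' a' -> vectors F n') (z : point_index s a -> vectors F n) :
  spanned_space x = fullv ->
  (forall p, exists q,
     ((code q).1 = (code p).1 /\ forall i, z q i = x p i *m phi i) \/
     exists i, [/\ (code p).1 = Some i, slot_allowed (code q).1 i &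
                   forall j, j != i -> z q j = x p j *m phi j]) ->
  forall t, tensor_map phi t \in spanned_space z.
Proof.
move=> full zx t; have := memvf t; rewrite -full spanned_spaceE.
case/memv_sumP=> ts tsP ->; rewrite linear_sum spanned_spaceE.
apply: rpred_sum => p _; have [q zxq] := zx p.
have /(tensor_map_span_at phi) := tsP p isT.
apply: subvP; apply: (sumv_sup q) => //.
case: zxq => [[-> zq]|[i [-> qi zq]]].
  by rewrite (span_at_eq _ zq).
by apply: subv_trans (Gspace_sub_span_at _ qi); rewrite (Gspace_eq zq).
Qed.

(** Every family arises by projection from a family on a larger index set, as the
    projections have sections. *)
Lemma extend_family (F : fieldType) (k : nat) (n' n : 'I_k -> nat)
    (phi : forall i, 'M[F]_((n' i).+1, (n i).+1))
    (psi : forall i, 'M[F]_((n i).+1, (n' i).+1))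
    (J : finType) (C : eqType) (h : J -> C) (x : J -> vectors F n') :
  (forall i, phi i *m psi i = 1%:M) -> injective h ->
  exists y : C -> vectors F n, forall p i, y (h p) i *m psi i = x p i.
Proof.
move=> phiK h_inj.
exists (fun c i => if [pick p | h p == c] is Some p then x p i *m phi i else 0).
move=> p i; case: pickP => [q /eqP/h_inj->|/(_ p)]; last by rewrite eqxx.
by rewrite -mulmxA phiK mulmx1.
Qed.

(** The factor i0 is the direct sum of the images of [phi' i0] and [phi'' i0], with
    projections [pi' i0] and [pi'' i0]; on the other factors all four maps are
    isomorphisms. *)
Section Degeneration.
Variables (F : fieldType) (charF0 : [pchar F] =i pred0).
Variables (k : nat) (i0 : 'I_k) (n n' n'' : 'I_k -> nat).
Variable phi' : forall i, 'M[F]_((n' i).+1, (n i).+1).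
Variable phi'' : forall i, 'M[F]_((n'' i).+1, (n i).+1).
Variable pi' : forall i, 'M[F]_((n i).+1, (n' i).+1).
Variable pi'' : forall i, 'M[F]_((n i).+1, (n'' i).+1).
Hypothesis phi'K : forall i, phi' i *m pi' i = 1%:M.
Hypothesis phi''K : forall i, phi'' i *m pi'' i = 1%:M.
Hypothesis pi'K : forall i, i != i0 -> pi' i *m phi' i = 1%:M.
Hypothesis pi''K : forall i, i != i0 -> pi'' i *m phi'' i = 1%:M.
Hypothesis split0 : pi' i0 *m phi' i0 + pi'' i0 *m phi'' i0 = 1%:M.

(** A pure tensor is additive in its component on the factor i0, and this
    component is the sum of its two projections; pure tensors span. *)
Lemma tensor_map_split (t : tensor F n) :
  exists t' t'', t = tensor_map phi' t' + tensor_map phi'' t''.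
Proof.
pose v (c : multi_index n) : vectors F n := fun i => delta_mx 0 (c i).
exists (\sum_(c : multi_index n) (t c : F) *: pure_tensor (fun i => v c i *m pi' i)).
exists (\sum_(c : multi_index n) (t c : F) *: pure_tensor (fun i => v c i *m pi'' i)).
rewrite {1}[t]tensor_sum_pure !linear_sum -big_split; apply: eq_bigr => c _ /=.
rewrite !linearZ /= !tensor_map_pure -scalerDr; congr (_ *: _).
transitivity (slot (v c) (v c i0 *m pi' i0 *m phi' i0) +
              slot (v c) (v c i0 *m pi'' i0 *m phi'' i0)).
  rewrite -linearD -!mulmxA -mulmxDr split0 mulmx1.
  by apply: pure_tensor_eq => i; case: dfwithP.
by congr (_ + _); apply: pure_tensor_eq => i; case: dfwithP => // j ij;
  rewrite -mulmxA ?pi'K ?pi''K ?mulmx1 1?eq_sym.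
Qed.

Variables (s' s'' : nat) (a a' a'' : 'I_k -> nat).
Hypothesis a'0 : a' i0 = (a i0 + s'')%N.
Hypothesis a''0 : a'' i0 = (a i0 + s')%N.
Hypothesis aE : forall i, i != i0 -> a i = (a' i + a'' i)%N.

Lemma exists_spanning_family :
  for_generic_points
    (fun x : point_index s' a' -> vectors F n' => spanned_space x = fullv) ->
  for_generic_points
    (fun x : point_index s'' a'' -> vectors F n'' => spanned_space x = fullv) ->
  exists2 z : point_index (s' + s'') a -> vectors F n,
    is_family z & spanned_space z = fullv.
Proof.
move=> [U' [oU' [x' fx' Ux'] fullU']] [U'' [oU'' [x'' fx'' Ux''] fullU'']].
have [y' y'E] := extend_family x' phi'K (code_left_inj a'0).
have [y'' y''E] := extend_family x'' phi''K (code_right_inj (a' := a') a''0).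
(* y' and y'' project to x' on the left and to x'' on the right respectively;
   X is the line through them, good on the left at 0 and on the right at 1 *)
pose L := code_left i0 s' a.
pose R := code_right i0 s' a a'.
pose X t c i := y' c i + t *: (y'' c i - y' c i).
pose u' (p : point_index s' a') i := y' (L (code p)) i *m pi' i.
pose w' (p : point_index s' a') i :=
  (y'' (L (code p)) i - y' (L (code p)) i) *m pi' i.
have x'E p i : x' p i = u' p i + 0 *: w' p i by rewrite scale0r addr0 -y'E.
pose u'' (p : point_index s'' a'') i := y' (R (code p)) i *m pi'' i.
pose w'' (p : point_index s'' a'') i :=
  (y'' (R (code p)) i - y' (R (code p)) i) *m pi'' i.
have x''E p i : x'' p i = u'' p i + 1 *: w'' p i.
  by rewrite scale1r -mulmxDl addrC subrK y''E.
have [t [[fz' /(fullU' _ fz') full'] [fz'' /(fullU'' _ fz'') full'']]] :=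
  almost_all_exists charF0 (almost_all_and
    (zariski_open_line oU' fx' Ux' x'E) (zariski_open_line oU'' fx'' Ux'' x''E)).
have X'E p i : u' p i + t *: w' p i = X t (L (code p)) i *m pi' i.
  by rewrite mulmxDl scalemxAl.
have X''E p i : u'' p i + t *: w'' p i = X t (R (code p)) i *m pi'' i.
  by rewrite mulmxDl scalemxAl.
(* the specialised family, which differs from X t on the factor i0 only *)
pose z c i := if on_left i0 s' a' c then X t c i *m pi' i *m phi' i
              else X t c i *m pi'' i *m phi'' i.
have zE c i : i != i0 -> z c i = X t c i.
  by move=> ni; rewrite /z -!mulmxA pi'K // pi''K // !mulmx1 if_same.
exists (fun p => z (code p)).
  move=> p i; have cv := code_valid p; rewrite /z; case: ifPn => cl.
    have [q qc] := code_left_onto a'0 cv cl; have := fz' q i.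
    rewrite X'E /L qc; apply: contraNneq => /(congr1 (mulmx^~ (pi' i))).
    by rewrite -mulmxA phi'K mulmx1 mul0mx => ->.
  have [q qc] := code_right_onto aE cv cl; have := fz'' q i.
  rewrite X''E /R qc; apply: contraNneq => /(congr1 (mulmx^~ (pi'' i))).
  by rewrite -mulmxA phi''K mulmx1 mul0mx => ->.
apply/eqP; rewrite eqEsubv subvf /=; apply/subvP => v _.
have [v' [v'' ->]] := tensor_map_split v; apply: rpredD.
  apply: tensor_map_sub_spanned full' _ v' => p.
  have [/code_surj[q qc] pP] := code_leftP p a'0 aE; exists q; rewrite qc.
  case: pP => [[cl c1]|[c0 sl]]; [left|right]; last exists i0; split=> // i.
    by rewrite X'E /z cl.
  by move=> ni; rewrite X'E zE // -mulmxA pi'K // mulmx1.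
apply: tensor_map_sub_spanned full'' _ v'' => p.
have [/code_surj[q qc] pP] := code_rightP p a''0 aE; exists q; rewrite qc.
case: pP => [[cl c1]|[c0 sl]]; [left|right]; last exists i0; split=> // i.
  by rewrite X''E /z (negPf cl).
by move=> ni; rewrite X''E zE // -mulmxA pi''K // mulmx1.
Qed.

End Degeneration.

(** * Splitting the first factor, and the count *)

(** The inclusion of the span of [p] consecutive basis vectors, from number [o]
    on; its transpose is the coordinate projection.  Indices may run past [q], in
    which case the row is zero. *)
Definition window_mx (F : fieldType) (o p q : nat) : 'M[F]_(p, q) :=
  \matrix_(b, c) (o + b == c)%N%:R.

Lemma window_mx_mul_tr (F : fieldType) (o p q : nat) : (o + p <= q)%N ->
  window_mx F o p q *m (window_mx F o p q)^T = 1%:M.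
Proof.
move=> opq; apply/matrixP => b b'; rewrite !mxE.
have bq : (o + b < q)%N by apply: leq_trans opq; rewrite ltn_add2l.
rewrite (bigD1 (Ordinal bq)) //= big1 => [|c ncb].
  by rewrite !mxE /= eqxx mul1r addr0 eqn_add2l eq_sym.
rewrite !mxE; case: eqP => [bc|_]; last by rewrite mul0r.
by move/eqP: ncb; case; apply: val_inj.
Qed.

Lemma window_mx_tr_mulE (F : fieldType) (o p q : nat) (c d : 'I_q) :
  ((window_mx F o p q)^T *m window_mx F o p q) c d =
  ((c == d) && (o <= c < o + p)%N)%:R.
Proof.
rewrite mxE; have [/andP[oc cp]|nocp] := boolP (o <= c < o + p)%N; last first.
  rewrite andbF big1 // => b _; rewrite !mxE; case: eqP => [cE|]; last by rewrite mul0r.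
  by move: nocp (ltn_ord b); rewrite -cE; lia.
have bp : (c - o < p)%N by lia.
rewrite andbT (bigD1 (Ordinal bp)) //= big1 => [|b].
  by rewrite !mxE /= subnKC // eqxx mul1r addr0.
rewrite -val_eqE !mxE /= => nb; case: eqP => [|_]; last by rewrite mul0r.
by move: nb => /eqP; lia.
Qed.

(** Under superabundance the expected dimension is that of the whole space. *)
Lemma T_true_full (F : fieldType) (k : nat) (n : k.-tuple nat) (s : nat)
    (a : k.-tuple nat) :
  T_superabundant n s a ->
  T_true F n s a <-> for_generic_points
    (fun x : point_index s (tnth a) -> vectors F (tnth n) =>
       spanned_space x = fullv).
Proof.
move=> sup; have dimE (x : point_index s (tnth a) -> vectors F (tnth n)) :
    \dim (spanned_space x) = minn (expected_count (tnth n) s (tnth a))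
      (ambient_dim (tnth n)) <-> spanned_space x = fullv.
  rewrite (minn_idPr sup) -(dim_tensor F); split=> [dimx|-> //].
  by apply/eqP; rewrite eqEdim subvf dimx /=.
by split=> -[U [oU exU PU]]; exists U; split=> // x fx Ux; apply/dimE/PU.
Qed.

(** The points p of one side are counted again with G^i0 on the other side: from
    n_i0 = n'_i0 + n''_i0 + 1, the two contributions of such a point add up to
    the dimension of its tangent space. *)
Lemma expected_count_split (k : nat) (i0 : 'I_k) (n n' n'' : 'I_k -> nat)
    (s' s'' : nat) (a a' a'' : 'I_k -> nat) :
  n i0 = (n' i0 + n'' i0 + 1)%N ->
  (forall i, i != i0 -> n' i = n i) -> (forall i, i != i0 -> n'' i = n i) ->
  a' i0 = (a i0 + s'')%N -> a'' i0 = (a i0 + s')%N ->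
  (forall i, i != i0 -> a i = a' i + a'' i)%N ->
  expected_count n (s' + s'') a = (expected_count n' s' a' + expected_count n'' s'' a'')%N.
Proof.
move=> n0 n'E n''E a'0 a''0 aE; rewrite /expected_count !(bigD1 (P := xpredT) i0) //=.
rewrite (eq_bigr _ n'E) (eq_bigr _ n''E).
have -> : (\sum_(i | i != i0) a i * (n i).+1 =
    \sum_(i | i != i0) a' i * (n' i).+1 + \sum_(i | i != i0) a'' i * (n'' i).+1)%N.
  by rewrite -big_split; apply: eq_bigr => i ni; rewrite n'E // n''E // aE // mulnDl.
rewrite n0 a'0 a''0; set A := (\sum_(i | _) a' i * _)%N.
set B := (\sum_(i | _) a'' i * _)%N; set S := (\sum_(i | _) n i)%N; nia.
Qed.

Lemma ambient_dim_split (k : nat) (i0 : 'I_k) (n n' n'' : 'I_k -> nat) :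
  n i0 = (n' i0 + n'' i0 + 1)%N ->
  (forall i, i != i0 -> n' i = n i) -> (forall i, i != i0 -> n'' i = n i) ->
  ambient_dim n = (ambient_dim n' + ambient_dim n'')%N.
Proof.
move=> n0 n'E n''E; rewrite /ambient_dim !(bigD1 (P := xpredT) i0) //= n0.
have -> : (\prod_(i | i != i0) (n' i).+1 = \prod_(i | i != i0) (n i).+1)%N.
  by apply: eq_bigr => i /n'E->.
have -> : (\prod_(i | i != i0) (n'' i).+1 = \prod_(i | i != i0) (n i).+1)%N.
  by apply: eq_bigr => i /n''E->.
by rewrite -mulnDl addn1 addSn addnS.
Qed.

(** The geometric content of the theorem, for an arbitrary factor [i0].  The
    splitting is along the standard basis: the first n'_i0 + 1 vectors and the
    n''_i0 + 1 others. *)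
Lemma generic_full_split (F : fieldType) (k : nat) (i0 : 'I_k)
    (n n' n'' : 'I_k -> nat) (s' s'' : nat) (a a' a'' : 'I_k -> nat) :
  [pchar F] =i pred0 ->
  n i0 = (n' i0 + n'' i0 + 1)%N ->
  (forall i, i != i0 -> n' i = n i) -> (forall i, i != i0 -> n'' i = n i) ->
  a' i0 = (a i0 + s'')%N -> a'' i0 = (a i0 + s')%N ->
  (forall i, i != i0 -> a i = a' i + a'' i)%N ->
  for_generic_points
    (fun x : point_index s' a' -> vectors F n' => spanned_space x = fullv) ->
  for_generic_points
    (fun x : point_index s'' a'' -> vectors F n'' => spanned_space x = fullv) ->
  for_generic_points
    (fun x : point_index (s' + s'') a -> vectors F n => spanned_space x = fullv).
Proof.
move=> charF0 n0 n'E n''E a'0 a''0 aE full' full''.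
pose offset i := if i == i0 then (n' i0).+1 else 0%N.
pose phi' i : 'M[F]_((n' i).+1, (n i).+1) := window_mx F 0 _ _.
pose phi'' i : 'M[F]_((n'' i).+1, (n i).+1) := window_mx F (offset i) _ _.
have phi'K i : phi' i *m (phi' i)^T = 1%:M.
  apply: window_mx_mul_tr; have [->|/n'E->] := eqVneq i i0; last by [].
  by rewrite n0; lia.
have phi''K i : phi'' i *m (phi'' i)^T = 1%:M.
  apply: window_mx_mul_tr; rewrite /offset.
  by have [->|/n''E->] := eqVneq i i0; lia.
have phi'T i : i != i0 -> (phi' i)^T *m phi' i = 1%:M.
  move=> ni; apply/matrixP => c d; rewrite window_mx_tr_mulE n'E //.
  by rewrite mxE leq0n add0n ltn_ord /= andbT.
have phi''T i : i != i0 -> (phi'' i)^T *m phi'' i = 1%:M.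
  move=> ni; apply/matrixP => c d; rewrite window_mx_tr_mulE n''E //.
  by rewrite mxE /offset (negPf ni) leq0n add0n ltn_ord /= andbT.
have phi0 : (phi' i0)^T *m phi' i0 + (phi'' i0)^T *m phi'' i0 = 1%:M.
  apply/matrixP => c d; rewrite mxE !window_mx_tr_mulE /offset eqxx mxE.
  have cn := ltn_ord c; have [_|_] := eqVneq c d; last by rewrite addr0.
  case: (ltnP c (n' i0).+1) => cn1; first by rewrite addr0.
  by have -> : (c < (n' i0).+1 + (n'' i0).+1)%N by [lia]; rewrite add0r.
have [z famz fullz] := exists_spanning_family charF0 phi'K phi''K phi'T phi''T
  phi0 a'0 a''0 aE full' full''.
have := @generic_full_of_spanning F _ _ _ (fun p => (code p).1) z famz.
rewrite -spanned_spaceE => /(_ fullz) [U [oU exU fullU]].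
by exists U; split=> // x fx /(fullU _ fx); rewrite -spanned_spaceE.
Qed.

Local Close Scope ring_scope.

Theorem theorem3p5 (F : fieldType) (charF0 : [pchar F]%R =i pred0)
    (m : nat) (n1 n1' n1'' : nat) (n : m.-tuple nat)
    (s s' s'' a1 : nat) (a a' a'' : m.-tuple nat)
    (n1E : n1 = n1' + n1'' + 1)
    (sE : s = s' + s'')
    (aE : forall j : 'I_m, tnth a j = tnth a' j + tnth a'' j)
    (H1 : T_true F [tuple of n1' :: n] s' [tuple of (a1 + s'') :: a'] /\
          T_superabundant [tuple of n1' :: n] s' [tuple of (a1 + s'') :: a'])
    (H2 : T_true F [tuple of n1'' :: n] s'' [tuple of (a1 + s') :: a''] /\
          T_superabundant [tuple of n1'' :: n] s'' [tuple of (a1 + s') :: a'']) :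
  T_true F [tuple of n1 :: n] s [tuple of a1 :: a] /\
  T_superabundant [tuple of n1 :: n] s [tuple of a1 :: a].
Proof.
have [/[swap] sup1 /(T_true_full _ sup1) full1] := H1.
have [/[swap] sup2 /(T_true_full _ sup2) full2] := H2.
set N := [tuple of n1 :: n]; set A := [tuple of a1 :: a].
set N1 := [tuple of n1' :: n] in sup1 full1.
set N2 := [tuple of n1'' :: n] in sup2 full2.
set A1 := [tuple of _ :: a'] in sup1 full1.
set A2 := [tuple of _ :: a''] in sup2 full2.
have tail (T : Type) (x y : T) (t : m.-tuple T) (i : 'I_m.+1) : i != ord0 ->
    tnth [tuple of x :: t] i = tnth [tuple of y :: t] i.
  by case: (unliftP ord0 i) => [j ->|->] //; rewrite !tnthS.
have N0 : tnth N ord0 = (tnth N1 ord0 + tnth N2 ord0 + 1) by rewrite !tnth0.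
have N1E i : i != ord0 -> tnth N1 i = tnth N i by apply: tail.
have N2E i : i != ord0 -> tnth N2 i = tnth N i by apply: tail.
have A10 : tnth A1 ord0 = (tnth A ord0 + s'') by rewrite !tnth0.
have A20 : tnth A2 ord0 = (tnth A ord0 + s') by rewrite !tnth0.
have AE i : i != ord0 -> tnth A i = (tnth A1 i + tnth A2 i).
  by case: (unliftP ord0 i) => [j ->|->] //; rewrite !tnthS.
have sup : T_superabundant N s A.
  rewrite /T_superabundant sE (expected_count_split N0 N1E N2E A10 A20 AE).
  by rewrite (ambient_dim_split N0 N1E N2E) leq_add.
split=> //; apply/(T_true_full _ sup); subst s.
exact: (generic_full_split charF0 N0 N1E N2E A10 A20 AE full1 full2).
Qed.
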